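(* Let $T>0$ and let $\theta,\eta:[0,T]\to(0,\infty)$ be continuously differentiable. If both the permanent impact $\theta$ and the temporary impact $\eta$ are increasing on $[0,T]$, then for every $Q>0$ the optimal solution $\zeta$ of the Optimal Execution Problem of maximizing $\mathcal{J}$ over $\Xi(Q)$ is monotonic, convex, and bounded from above by the TWAP strategy, i.e. $\zeta_t\le Q(1-t/T)$ for all $t\in[0,T]$. Consequently, neither transaction-triggered price manipulation nor price manipulation is possible.
   Context: $\Xi(Q)=\{\zeta\in\mathcal{C}^2([0,T]):\ \zeta_0=Q,\ \zeta_T=0\}$ and $$\mathcal{J}(\zeta)=\int_0^T\left(\theta_t\,\dot\zeta_t\,\zeta_t-\eta_t\,\dot\zeta_t^2\right)dt ,$$ which is the expected cash in excess of the initial mark-to-market value (minus the expected transaction cost). ''Increasing'' means non-decreasing. Monotonic means $\dot\zeta_t\le0$ for all $t$. The TWAP strategy is $t\mapsto Q(1-t/T)$. The model admits transaction-triggered price manipulation if there exist $Q>0$ and $\tilde\zeta\in\Xi(Q)$ with $\mathcal{J}(\tilde\zeta)>\sup\{\mathcal{J}(\zeta):\ \zeta\in\Xi(Q),\ \dot\zeta_t\le0\ \forall t\in[0,T]\}$. Price manipulation means that there exist $Q>0$ and $\zeta\in\Xi(Q)$ with negative expected transaction cost, i.e. $\mathcal{J}(\zeta)>0$. *)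

(* Defs.v *)
(* Stdlib reals with Coquelicot.

   Functions on [0,T] are represented by functions on R.  Every notion below is
   relative to [0,T], with one-sided derivatives and limits at the endpoints,
   so that the values outside [0,T] never matter. *)
From Stdlib Require Import Reals Lra.
From Coquelicot Require Import Coquelicot.
Open Scope R_scope.

Definition itv (T t : R) : Prop := 0 <= t <= T.

(* [D_in f (fun _ => l) (itv T) t] says that (f s - f t) / (s - t) tends to l
   as s tends to t within [0,T], s <> t. *)
Definition derivable_on (T : R) (f : R -> R) : Prop :=
  forall t, itv T t -> exists l, D_in f (fun _ => l) (itv T) t.

(* The derivative relative to [0,T]; meaningful where it exists, see
   [deriv_correct]. *)
Definition deriv (T : R) (f : R -> R) (t : R) : R :=
  iota (fun l : R => D_in f (fun _ => l) (itv T) t).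

Definition continuous_within (T : R) (f : R -> R) : Prop :=
  forall t, itv T t -> continue_in f (itv T) t.

Definition C1_on (T : R) (f : R -> R) : Prop :=
  derivable_on T f /\ continuous_within T (deriv T f).

Definition C2_on (T : R) (f : R -> R) : Prop :=
  C1_on T f /\ C1_on T (deriv T f).

Definition positive_on (T : R) (f : R -> R) : Prop :=
  forall t, itv T t -> 0 < f t.

Definition increasing_on (T : R) (f : R -> R) : Prop :=
  forall s t, itv T s -> itv T t -> s <= t -> f s <= f t.

Definition convex_on (T : R) (f : R -> R) : Prop :=
  forall s t a, itv T s -> itv T t -> 0 <= a <= 1 ->
    f (a * s + (1 - a) * t) <= a * f s + (1 - a) * f t.

Definition Xi (T Q : R) (zeta : R -> R) : Prop :=
  C2_on T zeta /\ zeta 0 = Q /\ zeta T = 0.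

Definition J (T : R) (theta eta zeta : R -> R) : R :=
  RInt (fun t => theta t * deriv T zeta t * zeta t
                 - eta t * (deriv T zeta t) ^ 2) 0 T.

Definition monotonic (T : R) (zeta : R -> R) : Prop :=
  forall t, itv T t -> deriv T zeta t <= 0.

Definition TWAP (T Q t : R) : R := Q * (1 - t / T).

Definition optimal (T : R) (theta eta : R -> R) (Q : R) (zeta : R -> R) : Prop :=
  Xi T Q zeta /\
  forall xi, Xi T Q xi -> J T theta eta xi <= J T theta eta zeta.

(* The supremum is taken in the extended reals. *)
Definition transaction_triggered_price_manipulation
    (T : R) (theta eta : R -> R) : Prop :=
  exists (Q : R) (zt : R -> R), 0 < Q /\ Xi T Q zt /\
    Rbar_lt
      (Lub_Rbar (fun x => exists zeta,
         Xi T Q zeta /\ monotonic T zeta /\ x = J T theta eta zeta))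
      (J T theta eta zt).

(* [J] is minus the expected transaction cost. *)
Definition price_manipulation (T : R) (theta eta : R -> R) : Prop :=
  exists (Q : R) (zeta : R -> R),
    0 < Q /\ Xi T Q zeta /\ 0 < J T theta eta zeta.

Lemma adhDa_itv (T t : R) : 0 < T -> itv T t -> adhDa (D_x (itv T) t) t.
Proof.
unfold itv; intros HT Ht e He; simpl; unfold R_dist.
destruct (Rle_lt_dec t (T / 2)).
- assert (H := Rmin_l (e / 2) (T / 2)); assert (H' := Rmin_r (e / 2) (T / 2)).
  assert (0 < Rmin (e / 2) (T / 2)) by (apply Rmin_glb_lt; lra).
  exists (t + Rmin (e / 2) (T / 2)); unfold D_x.
  repeat split; try lra; rewrite Rabs_pos_eq; lra.
- assert (H := Rmin_l (e / 2) (T / 2)); assert (H' := Rmin_r (e / 2) (T / 2)).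
  assert (0 < Rmin (e / 2) (T / 2)) by (apply Rmin_glb_lt; lra).
  exists (t - Rmin (e / 2) (T / 2)); unfold D_x.
  repeat split; try lra; rewrite Rabs_left; lra.
Qed.

Lemma deriv_correct (T : R) (f : R -> R) (t l : R) :
  0 < T -> itv T t -> D_in f (fun _ => l) (itv T) t -> deriv T f t = l.
Proof.
intros HT Ht Hl.
assert (U : forall l', D_in f (fun _ => l') (itv T) t -> l' = l).
{ intros l' Hl'.
  exact (single_limit _ _ _ _ _ (adhDa_itv T t HT Ht) Hl' Hl). }
apply U; unfold deriv.
apply (iota_correct (V := R_CompleteNormedModule)
         (fun l : R => D_in f (fun _ => l) (itv T) t)).
exists l; split; [exact Hl | intros l' Hl'; symmetry; exact (U l' Hl')].
Qed.

(* Main.v *)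
(* Reversing time, the Euler-Lagrange equation (eta z')' = theta' z / 2 becomes a
   linear system u' = A v, v' = G u with nonnegative coefficients and data
   u(0) = 0, v(0) = 1, solved by a contraction argument; scaling u gives the
   boundary values and signs of the extremal.  Integrating by parts, the cash lost
   by any other strategy x is the integral of theta'/2 (x - z)^2 + eta (x' - z')^2,
   which proves optimality and uniqueness, and (for z = 0) J <= 0.  Finally
   z' = - p / eta with p nonnegative and non-increasing, so z is non-increasing
   and convex, and convexity gives the bound by the chord (TWAP). *)
Require Import Defs.
From Stdlib Require Import Reals Lra Psatz.
From Coquelicot Require Import Coquelicot.
Open Scope R_scope.

(** * Retraction of the line onto [0,T] and elementary calculus *)

Definition clamp (T t : R) : R := Rmax 0 (Rmin T t).

Lemma clamp_itv (T t : R) : 0 < T -> itv T (clamp T t).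
Proof.
intros hT; unfold itv, clamp, Rmax, Rmin.
repeat destruct Rle_dec; lra.
Qed.

Lemma clamp_id (T t : R) : itv T t -> clamp T t = t.
Proof.
unfold itv, clamp, Rmax, Rmin; intros [h0 h1].
repeat destruct Rle_dec; lra.
Qed.

Lemma clamp_dist (T s t : R) :
  0 < T -> Rabs (clamp T s - clamp T t) <= Rabs (s - t).
Proof.
intros hT; unfold clamp, Rmax, Rmin.
repeat destruct Rle_dec; unfold Rabs; repeat destruct Rcase_abs; lra.
Qed.

(** The retraction is 1-Lipschitz, so a modulus of continuity relative to [0,T] also serves on the
    whole line. This makes relative data accessible to integration theorems stated for two-sided
    continuity. *)
Lemma continuous_clamp (T : R) (f : R -> R) :
  0 < T -> continuous_within T f ->
  forall t, continuous (fun s => f (clamp T s)) t.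
Proof.
intros hT hf t; apply continuity_pt_filterlim.
intros eps heps.
destruct (hf (clamp T t) (clamp_itv T t hT) eps heps) as [alp [halp H]].
exists alp; split; [exact halp|].
intros s [_ hs]; simpl in *; unfold R_dist in *.
(* Relative continuity only speaks of points distinct from the base point, and clamping may identify
   [s] with [t]. *)
destruct (Req_dec (clamp T t) (clamp T s)) as [e|ne].
- rewrite e, Rminus_diag, Rabs_R0; lra.
- apply H; split.
  + split; [apply clamp_itv, hT | exact ne].
  + apply Rle_lt_trans with (2 := hs), clamp_dist, hT.
Qed.

Lemma is_derive_continuous (f : R -> R) (t l : R) :
  is_derive f t l -> continuous f t.
Proof.
intros h; apply (ex_derive_continuous (V := R_NormedModule)); exists l; exact h.
Qed.

Lemma derivative_nonneg_le (f df : R -> R) (a b : R) :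
  a <= b -> (forall x, a <= x <= b -> is_derive f x (df x)) ->
  (forall x, a <= x <= b -> 0 <= df x) -> f a <= f b.
Proof.
intros hab hd hp.
destruct (MVT_gen f a b df) as [c [hc e]];
  rewrite Rmin_left, Rmax_right in * by lra.
- intros x hx; apply hd; lra.
- intros x hx; apply continuity_pt_filterlim.
  apply (is_derive_continuous f x (df x)), hd; lra.
- specialize (hp c hc); nra.
Qed.

Lemma derivative_zero_eq (f : R -> R) (a b : R) :
  a <= b -> (forall x, a < x < b -> is_derive f x 0) ->
  (forall x, a <= x <= b -> continuous f x) -> f a = f b.
Proof.
intros hab hd hc.
destruct (MVT_gen f a b (fun _ => 0)) as [c [_ e]];
  rewrite ?Rmin_left, ?Rmax_right in * by lra.
- exact hd.
- intros x hx; apply continuity_pt_filterlim, hc, hx.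
- lra.
Qed.

Lemma is_derive_RInt_continuous (f : R -> R) (a t : R) :
  (forall s, continuous f s) -> is_derive (fun s => RInt f a s) t (f t).
Proof.
intros hf.
apply is_derive_RInt with (a := a); [|apply hf].
apply filter_forall; intros s.
apply (@RInt_correct R_CompleteNormedModule).
apply (@ex_RInt_continuous R_CompleteNormedModule).
intros; apply hf.
Qed.

(** * Derivatives relative to [0,T] versus ordinary derivatives *)

Lemma D_in_interior (T : R) (f : R -> R) (t l : R) :
  0 < t < T -> D_in f (fun _ => l) (itv T) t -> is_derive f t l.
Proof.
intros ht hd; apply is_derive_Reals; intros eps heps.
destruct (hd eps heps) as [alp [halp H]].
assert (hm : 0 < Rmin alp (Rmin t (T - t)))
  by (repeat apply Rmin_glb_lt; lra).
exists (mkposreal _ hm); simpl; intros h h0 hh.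
assert (h1 := Rmin_l alp (Rmin t (T - t))).
assert (h2 := Rmin_r alp (Rmin t (T - t))).
assert (h3 := Rmin_l t (T - t)); assert (h4 := Rmin_r t (T - t)).
simpl in H; unfold R_dist in H.
assert (K := H (t + h)).
replace (t + h - t) with h in K by ring.
assert (hb : - (Rmin alp (Rmin t (T - t))) < h < Rmin alp (Rmin t (T - t)))
  by (apply Rabs_def2 in hh; lra).
apply K; repeat split; unfold itv; try lra.
Qed.

Lemma is_derive_D_in (T : R) (f F : R -> R) (t l : R) :
  itv T t -> (forall s, itv T s -> f s = F s) -> is_derive F t l ->
  D_in f (fun _ => l) (itv T) t.
Proof.
intros ht e hd eps heps; apply is_derive_Reals in hd.
destruct (hd eps heps) as [alp H].
exists alp; split; [apply cond_pos|].
simpl; unfold R_dist; intros x [[hx ne] hxt].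
rewrite (e x hx), (e t ht).
replace (F x) with (F (t + (x - t))) by (f_equal; ring).
apply H; [lra | exact hxt].
Qed.

Lemma deriv_D_in (T : R) (f : R -> R) (t : R) :
  0 < T -> derivable_on T f -> itv T t ->
  D_in f (fun _ => deriv T f t) (itv T) t.
Proof.
intros hT hf ht; destruct (hf t ht) as [l hl].
rewrite (deriv_correct T f t l hT ht hl); exact hl.
Qed.

(** The extension integrates the clamped derivative from the value [f 0]. It allows two-sided
    calculus at the endpoints, where the original function has only one-sided data. *)
Lemma C1_on_extension (T : R) (f : R -> R) :
  0 < T -> C1_on T f ->
  exists F dF : R -> R,
    (forall t, is_derive F t (dF t)) /\ (forall t, continuous dF t) /\
    (forall t, itv T t -> F t = f t /\ dF t = deriv T f t).
Proof.
intros hT [hd hc].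
set (dF := fun t => deriv T f (clamp T t)).
assert (hdF : forall t, continuous dF t) by exact (continuous_clamp T _ hT hc).
assert (hF : forall t, is_derive (fun s => f 0 + RInt dF 0 s) t (dF t)).
{ intros t;
  replace (dF t) with (plus 0 (dF t)) by apply Rplus_0_l.
  apply @is_derive_plus; [apply @is_derive_const|].
  apply is_derive_RInt_continuous, hdF. }
exists (fun t => f 0 + RInt dF 0 t), dF; split; [exact hF|].
split; [exact hdF|]; intros t ht; split; cycle 1.
{ unfold dF; rewrite clamp_id; auto. }
assert (h0 : itv T 0) by (unfold itv; lra).
(* Clamping [f] makes the difference continuous in the two-sided sense at 0 and [T]; a zero
   derivative is then needed only in the interior. *)
set (h := fun s => f (clamp T s) - (f 0 + RInt dF 0 s)).
assert (E : h 0 = h t).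
{ apply derivative_zero_eq; [apply ht | |].
  - intros x hx; destruct ht as [_ ht].
    replace 0 with (minus (dF x) (dF x)) by apply Rminus_diag.
    apply @is_derive_minus; [|apply hF].
    assert (hx' : 0 < x < T) by lra.
    apply is_derive_ext_loc with f.
    + assert (hm : 0 < Rmin x (T - x)) by (apply Rmin_glb_lt; lra).
      exists (mkposreal _ hm); intros y hy.
      change (Rabs (y - x) < Rmin x (T - x)) in hy.
      assert (h3 := Rmin_l x (T - x)); assert (h4 := Rmin_r x (T - x)).
      apply Rabs_def2 in hy; rewrite clamp_id; [reflexivity | unfold itv; lra].
    + unfold dF; rewrite clamp_id by (unfold itv; lra).
      apply (D_in_interior T); [exact hx'|].
      apply deriv_D_in; auto; unfold itv; lra.
  - intros x _; apply @continuous_minus.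
    + apply continuous_clamp; [exact hT|]; intros s hs.
      eapply cont_deriv, deriv_D_in; auto.
    + eapply is_derive_continuous, hF. }
unfold h in E; rewrite RInt_point, !clamp_id in E by assumption.
unfold zero in E; simpl in E; lra.
Qed.

(** The way back from ordinary calculus: it certifies that explicitly constructed functions are C1
    on [0,T] and identifies their [deriv] there. *)
Lemma C1_on_restriction (T : R) (f F dF : R -> R) :
  0 < T -> (forall t, itv T t -> f t = F t) ->
  (forall t, itv T t -> is_derive F t (dF t)) ->
  (forall t, itv T t -> continuous dF t) ->
  C1_on T f /\ (forall t, itv T t -> deriv T f t = dF t).
Proof.
intros hT e hd hc.
assert (D : forall t, itv T t -> D_in f (fun _ => dF t) (itv T) t)
  by (intros t ht; apply is_derive_D_in with F; auto).
assert (E : forall t, itv T t -> deriv T f t = dF t)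
  by (intros t ht; apply deriv_correct; auto).
split; [split | exact E].
- intros t ht; exists (dF t); auto.
- intros t ht eps heps.
  assert (hc' := hc t ht); apply continuity_pt_filterlim in hc'.
  destruct (hc' eps heps) as [alp [halp H]].
  exists alp; split; [exact halp|].
  intros x [[hx ne] hxt]; rewrite !E by assumption.
  apply H; split; [split; [exact I | exact ne] | exact hxt].
Qed.

Lemma increasing_deriv_nonneg (T : R) (f : R -> R) (t : R) :
  0 < T -> derivable_on T f -> increasing_on T f -> itv T t ->
  0 <= deriv T f t.
Proof.
intros hT hd hi ht.
destruct (Rle_lt_dec 0 (deriv T f t)) as [h|h]; [exact h | exfalso].
(* With tolerance [- deriv T f t], a negative derivative would make nearby difference quotients
   negative, whereas those of an increasing function are nonnegative. *)
destruct (deriv_D_in T f t hT hd ht (- deriv T f t)) as [alp [halp H]]; [lra|].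
destruct (adhDa_itv T t hT ht alp halp) as [x [hx hxt]].
assert (K := H x (conj hx hxt)); destruct hx as [hx ne].
simpl in K; unfold R_dist in K; apply Rabs_def2 in K.
assert (0 <= (f x - f t) / (x - t)); [|lra].
destruct (Rlt_le_dec t x) as [l|l].
- apply Rdiv_le_0_compat; [|lra].
  assert (f t <= f x) by (apply hi; auto; lra); lra.
- replace ((f x - f t) / (x - t)) with ((f t - f x) / (t - x)) by (field; lra).
  apply Rdiv_le_0_compat; [|lra].
  assert (f x <= f t) by (apply hi; auto; lra); lra.
Qed.

(** * The linear system as a Volterra fixed-point problem *)

Lemma Rabs_le_derivative (f df h dh : R -> R) (T : R) :
  (forall x, itv T x -> is_derive f x (df x)) ->
  (forall x, itv T x -> is_derive h x (dh x)) ->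
  (forall x, itv T x -> Rabs (df x) <= dh x) ->
  Rabs (f 0) <= h 0 ->
  forall t, itv T t -> Rabs (f t) <= h t.
Proof.
intros hf hh hle h0 t [ht0 htT].
assert (K : forall x, 0 <= x <= t -> itv T x) by (unfold itv; intros; lra).
(* Both [h + f] and [h - f] start nonnegative and have nonnegative derivative. *)
apply Rabs_le_between in h0; apply Rabs_le; split.
- assert (H := derivative_nonneg_le (fun x => h x + f x)
                 (fun x => plus (dh x) (df x)) 0 t ht0).
  enough (h 0 + f 0 <= h t + f t) by lra; apply H.
  + intros x hx; apply @is_derive_plus; auto.
  + intros x hx; specialize (hle x (K x hx)); apply Rabs_le_between in hle.
    unfold plus; simpl; lra.
- assert (H := derivative_nonneg_le (fun x => h x - f x)
                 (fun x => minus (dh x) (df x)) 0 t ht0).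
  enough (h 0 - f 0 <= h t - f t) by lra; apply H.
  + intros x hx; apply @is_derive_minus; auto.
  + intros x hx; specialize (hle x (K x hx)); apply Rabs_le_between in hle.
    unfold minus, plus, opp; simpl; lra.
Qed.

(** Integrating v' = G u from v(0) = 1, and then u' = A v from u(0) = 0, turns the system into the
    single equation u = [volterra A G u], with v = [volterra_inner G u]. *)
Definition volterra_inner (G y : R -> R) (s : R) : R :=
  1 + RInt (fun r => G r * y r) 0 s.

Definition volterra (A G y : R -> R) (t : R) : R :=
  RInt (fun s => A s * volterra_inner G y s) 0 t.

Lemma is_derive_volterra_inner (G y : R -> R) (t : R) :
  (forall s, continuous G s) -> (forall s, continuous y s) ->
  is_derive (volterra_inner G y) t (G t * y t).
Proof.
intros hG hy; unfold volterra_inner.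
replace (G t * y t) with (plus 0 (G t * y t)) by apply Rplus_0_l.
apply @is_derive_plus; [apply @is_derive_const|].
apply (is_derive_RInt_continuous (fun r => G r * y r)).
intros s; apply (continuous_mult G y); auto.
Qed.

Lemma continuous_volterra_integrand (A G y : R -> R) (t : R) :
  (forall s, continuous A s) -> (forall s, continuous G s) ->
  (forall s, continuous y s) ->
  continuous (fun s => A s * volterra_inner G y s) t.
Proof.
intros hA hG hy; apply (continuous_mult A (volterra_inner G y)); [apply hA|].
eapply is_derive_continuous, is_derive_volterra_inner; auto.
Qed.

Lemma is_derive_volterra (A G y : R -> R) (t : R) :
  (forall s, continuous A s) -> (forall s, continuous G s) ->
  (forall s, continuous y s) ->
  is_derive (volterra A G y) t (A t * volterra_inner G y t).
Proof.
intros hA hG hy.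
apply (is_derive_RInt_continuous (fun s => A s * volterra_inner G y s)).
intros s; apply continuous_volterra_integrand; auto.
Qed.

Lemma volterra_nonneg (A G y : R -> R) (T : R) :
  (forall s, continuous A s) -> (forall s, continuous G s) ->
  (forall s, continuous y s) ->
  (forall s, itv T s -> 0 <= A s /\ 0 <= G s /\ 0 <= y s) ->
  forall t, itv T t -> 0 <= volterra A G y t.
Proof.
intros hA hG hy hp t [ht0 htT]; apply RInt_ge_0; [exact ht0 | |].
- apply (@ex_RInt_continuous R_CompleteNormedModule).
  intros; apply continuous_volterra_integrand; auto.
- intros s hs; apply Rmult_le_pos; [apply hp; unfold itv; lra|].
  unfold volterra_inner.
  enough (0 <= RInt (fun r => G r * y r) 0 s) by lra.
  apply RInt_ge_0; [lra | |].
  + apply (@ex_RInt_continuous R_CompleteNormedModule).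
    intros; apply (continuous_mult G y); auto.
  + intros r hr; apply Rmult_le_pos; apply hp; unfold itv; lra.
Qed.

Lemma is_derive_exp_scale (k c t : R) :
  is_derive (fun s => k * exp (c * s)) t (k * c * exp (c * t)).
Proof. auto_derive; [exact I | ring]. Qed.

(* In the norm weighted by [exp (- lam t)] each of the two integrations gains a
   factor [1 / lam], and [2 * a * g <= lam ^ 2]. *)
Lemma volterra_contraction (A G y z : R -> R) (T a g c : R) :
  (forall s, continuous A s) -> (forall s, continuous G s) ->
  (forall s, continuous y s) -> (forall s, continuous z s) ->
  (forall s, itv T s -> 0 <= A s <= a /\ 0 <= G s <= g) ->
  0 <= a -> 0 <= g -> 0 <= c ->
  (forall s, itv T s -> Rabs (y s - z s) <= c * exp ((1 + a * g) * s)) ->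
  forall t, itv T t ->
    Rabs (volterra A G y t - volterra A G z t)
      <= c / 2 * exp ((1 + a * g) * t).
Proof.
intros hA hG hy hz hb ha hg hc hyz.
assert (hag : 0 <= a * g) by (apply Rmult_le_pos; lra).
set (lam := 1 + a * g) in *.
assert (hl : 1 <= lam) by (unfold lam; lra).
(* The constant after the first integration: the integral of [g * c * exp (lam * s)] is at most
   [k * exp (lam * s)]. *)
set (k := g * c / lam).
assert (hk0 : 0 <= k)
  by (apply Rdiv_le_0_compat; [apply Rmult_le_pos |]; lra).
assert (hk : k * lam = g * c) by (unfold k; field; lra).
assert (I : forall s, itv T s ->
  Rabs (volterra_inner G y s - volterra_inner G z s) <= k * exp (lam * s)).
{ apply Rabs_le_derivative with (fun s => minus (G s * y s) (G s * z s))
    (fun s => k * lam * exp (lam * s)).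
  - intros x _; apply @is_derive_minus; apply is_derive_volterra_inner; auto.
  - intros x _; apply is_derive_exp_scale.
  - intros x hx; rewrite hk.
    change (Rabs (G x * y x - G x * z x) <= g * c * exp (lam * x)).
    rewrite <- Rmult_minus_distr_l, Rabs_mult, Rmult_assoc.
    destruct (hb x hx) as [_ hGx].
    rewrite (Rabs_pos_eq (G x)) by lra.
    apply Rmult_le_compat; auto; try apply Rabs_pos; lra.
  - unfold volterra_inner; rewrite !RInt_point, Rminus_diag, Rabs_R0.
    apply Rmult_le_pos; [exact hk0 | left; apply exp_pos]. }
apply Rabs_le_derivative with
  (fun s => minus (A s * volterra_inner G y s) (A s * volterra_inner G z s))
  (fun s => c / 2 * lam * exp (lam * s)).
- intros x _; apply @is_derive_minus; apply is_derive_volterra; auto.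
- intros x _; apply is_derive_exp_scale.
- intros x hx.
  change (Rabs (A x * volterra_inner G y x - A x * volterra_inner G z x)
            <= c / 2 * lam * exp (lam * x)).
  rewrite <- Rmult_minus_distr_l, Rabs_mult.
  destruct (hb x hx) as [hAx _]; rewrite (Rabs_pos_eq (A x)) by lra.
  apply Rle_trans with (a * (k * exp (lam * x))).
  + apply Rmult_le_compat; auto; try apply Rabs_pos; lra.
  + rewrite <- Rmult_assoc; apply Rmult_le_compat_r; [left; apply exp_pos|].
    apply Rmult_le_reg_r with lam; [lra|].
    replace (a * k * lam) with (a * (k * lam)) by ring; rewrite hk.
    replace (a * (g * c)) with (a * g * c) by ring.
    (* The remaining inequality follows from [lam ^ 2 - 2 * a * g = 1 + (a * g) ^ 2]. *)
    assert (hsq : 0 <= (a * g) ^ 2) by apply pow2_ge_0.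
    assert (0 <= c * (1 + (a * g) ^ 2)) by (apply Rmult_le_pos; lra).
    unfold lam; lra.
- unfold volterra; rewrite !RInt_point, Rminus_diag, Rabs_R0.
  apply Rmult_le_pos; [lra | left; apply exp_pos].
Qed.

Lemma continuous_bounded_above (T : R) (f : R -> R) :
  0 < T -> (forall s, continuous f s) ->
  exists m, 0 <= m /\ forall s, itv T s -> f s <= m.
Proof.
intros hT hf; destruct (continuity_ab_maj f 0 T) as [x [hx _]]; [lra | |].
- intros s _; apply continuity_pt_filterlim, hf.
- exists (Rmax 0 (f x)); split; [apply Rmax_l|].
  intros s hs; apply Rle_trans with (f x); [apply hx, hs | apply Rmax_r].
Qed.

Lemma geometric_step_cauchy (y : nat -> R) (c : R) :
  0 <= c ->
  (forall n, Rabs (y (S n) - y n) <= c * (/ 2) ^ n) ->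
  forall n k, Rabs (y (n + k)%nat - y n) <= 2 * c * (/ 2) ^ n.
Proof.
intros hc hy n k.
assert (hp : forall m, 0 < (/ 2) ^ m) by (intros m; apply pow_lt; lra).
(* The exact geometric partial sum replaces its upper bound, so that the induction on [k] closes. *)
enough (Rabs (y (n + k)%nat - y n) <= 2 * c * ((/ 2) ^ n - (/ 2) ^ (n + k))).
{ specialize (hp (n + k)%nat); nra. }
induction k as [|k IH].
- rewrite Nat.add_0_r, Rminus_diag, Rabs_R0; lra.
- rewrite Nat.add_succ_r; specialize (hy (n + k)%nat).
  replace (y (S (n + k)) - y n)
    with ((y (S (n + k)) - y (n + k)%nat) + (y (n + k)%nat - y n)) by ring.
  apply Rle_trans with (1 := Rabs_triang _ _); simpl; lra.
Qed.

Lemma is_lim_seq_half_pow (c : R) : is_lim_seq (fun n => c * (/ 2) ^ n) 0.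
Proof.
replace (Finite 0) with (Rbar_mult c 0) by (simpl; f_equal; ring).
apply is_lim_seq_scal_l, is_lim_seq_geom; rewrite Rabs_pos_eq; lra.
Qed.

Lemma half_pow_small (c e : R) :
  0 < e -> exists N, forall n, (N <= n)%nat -> Rabs (c * (/ 2) ^ n) < e.
Proof.
intros he; destruct (proj2 (is_lim_seq_spec _ _) (is_lim_seq_half_pow c)
  (mkposreal e he)) as [N H].
exists N; intros n hn; specialize (H n hn); simpl in H.
rewrite Rminus_0_r in H; exact H.
Qed.

(** The error bound depends on the sequence only through [c]; applied pointwise to a sequence of
    functions it therefore gives uniform convergence. *)
Lemma geometric_step_lim (y : nat -> R) (c : R) :
  0 <= c ->
  (forall n, Rabs (y (S n) - y n) <= c * (/ 2) ^ n) ->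
  is_lim_seq y (Finite (real (Lim_seq y))) /\
  forall n, Rabs (real (Lim_seq y) - y n) <= 2 * c * (/ 2) ^ n.
Proof.
intros hc hy.
assert (H := geometric_step_cauchy y c hc hy).
assert (L : is_lim_seq y (Finite (real (Lim_seq y)))).
{ apply Lim_seq_correct', ex_lim_seq_cauchy_corr; intros eps.
  (* Two terms beyond [N] each lie within [2 * c * (/ 2) ^ N] of [y N], hence the factor 4. *)
  destruct (half_pow_small (4 * c) eps (cond_pos eps)) as [N hN].
  exists N; intros n m hn hm.
  specialize (hN N (le_n N)); apply Rabs_def2 in hN.
  assert (h1 := H N (n - N)%nat); assert (h2 := H N (m - N)%nat).
  replace (N + (n - N))%nat with n in h1 by lia.
  replace (N + (m - N))%nat with m in h2 by lia.
  apply Rabs_le_between in h1; apply Rabs_le_between in h2; apply Rabs_def1; lra. }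
split; [exact L|]; intros n.
assert (L' : is_lim_seq (fun k => Rabs (y (k + n)%nat - y n))
               (Rabs (real (Lim_seq y) - y n))).
{ apply (is_lim_seq_abs _ (Finite (real (Lim_seq y) - y n))).
  apply is_lim_seq_minus'; [|apply is_lim_seq_const].
  apply (is_lim_seq_incr_n y n), L. }
refine (is_lim_seq_le _ _ _ _ _ L' (is_lim_seq_const _)).
intros k; simpl; rewrite Nat.add_comm; apply H.
Qed.

(** Picard iteration from 0. Successive differences halve in the weighted norm, so the iterates
    converge uniformly on [0,T]; continuity and nonnegativity pass to the limit. *)
Lemma volterra_fixed_point (T : R) (A G : R -> R) :
  0 < T -> (forall s, continuous A s) -> (forall s, continuous G s) ->
  (forall s, itv T s -> 0 <= A s /\ 0 <= G s) ->
  exists Y : R -> R, (forall s, continuous Y s) /\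
    forall t, itv T t -> volterra A G Y t = Y t /\ 0 <= Y t.
Proof.
intros hT hA hG hp.
destruct (continuous_bounded_above T A hT hA) as [a [ha hAa]].
destruct (continuous_bounded_above T G hT hG) as [g [hg hGg]].
set (lam := 1 + a * g).
assert (hlam : 0 <= lam) by (unfold lam; nra).
assert (hexp : forall t, itv T t -> 1 <= exp (lam * t) <= exp (lam * T)).
{ assert (M : forall x y, x <= y -> exp x <= exp y)
    by (intros x y [h | ->]; [left; apply exp_increasing, h | lra]).
  intros t [h0 h1]; rewrite <- exp_0 at 1; split; apply M; nra. }
set (y := fix y (n : nat) : R -> R :=
  match n with O => fun _ => 0 | S n => volterra A G (y n) end).
assert (hy : forall n s, continuous (y n) s).
{ induction n as [|n IH]; intros s; simpl; [apply continuous_const|].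
  eapply is_derive_continuous, is_derive_volterra; auto. }
assert (hy0 : forall n s, itv T s -> 0 <= y n s).
{ induction n as [|n IH]; simpl; [intros; lra|].
  apply volterra_nonneg; auto; intros s hs; destruct (hp s hs); auto. }
destruct (continuous_bounded_above T (y 1%nat) hT (hy 1%nat)) as [c [hc hyc]].
assert (hpow : forall n, 0 < (/ 2) ^ n) by (intros n; apply pow_lt; lra).
assert (hbd : forall s, itv T s -> 0 <= A s <= a /\ 0 <= G s <= g)
  by (intros s hs; destruct (hp s hs); auto).
assert (step : forall n t, itv T t ->
  Rabs (y (S n) t - y n t) <= c * (/ 2) ^ n * exp (lam * t)).
{ induction n as [|n IH]; intros t ht.
  - specialize (hyc t ht); specialize (hy0 1%nat t ht); simpl in *.
    rewrite Rminus_0_r, Rabs_pos_eq by assumption.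
    destruct (hexp t ht); nra.
  - replace (c * (/ 2) ^ S n) with (c * (/ 2) ^ n / 2) by (simpl; field).
    refine (volterra_contraction A G (y (S n)) (y n) T a g (c * (/ 2) ^ n)
              hA hG (hy _) (hy _) hbd ha hg _ IH t ht).
    apply Rmult_le_pos; [exact hc | left; apply hpow]. }
(* Absorbing the largest weight into [C] turns the weighted bound into one uniform in [t]. *)
set (C := c * exp (lam * T)).
assert (hC : 0 <= C) by (apply Rmult_le_pos; [exact hc | left; apply exp_pos]).
assert (stepC : forall t, itv T t -> forall n,
  Rabs (y (S n) t - y n t) <= C * (/ 2) ^ n).
{ intros t ht n; apply Rle_trans with (1 := step n t ht).
  destruct (hexp t ht) as [_ h]; unfold C.
  assert (0 <= c * (/ 2) ^ n) by (apply Rmult_le_pos; [|left]; auto); nra. }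
(* The iterates are controlled only on [0,T]; clamping the argument makes convergence uniform on the
   whole line. *)
set (Y := fun t => real (Lim_seq (fun n => y n (clamp T t)))).
assert (hY : forall t n,
  Rabs (Y t - y n (clamp T t)) <= 2 * C * (/ 2) ^ n).
{ intros t n; unfold Y.
  exact (proj2 (geometric_step_lim _ C hC (stepC _ (clamp_itv T t hT))) n). }
assert (cY : forall t, continuous Y t).
{ intros t; apply continuity_pt_filterlim.
  apply (CVU_continuity (fun n s => y n (clamp T s)) Y t (mkposreal 1 Rlt_0_1)).
  - intros eps heps; destruct (half_pow_small (2 * C) eps heps) as [N hN].
    exists N; intros n s hn _; apply Rle_lt_trans with (1 := hY s n).
    apply Rle_lt_trans with (1 := Rle_abs _), hN, hn.
  - intros n s _; apply continuity_pt_filterlim, (continuous_clamp T (y n) hT).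
    intros x _; assert (h := hy n x); apply continuity_pt_filterlim in h.
    intros eps heps; destruct (h eps heps) as [alp [halp H]].
    exists alp; split; [exact halp|]; intros z [[_ ne] hz].
    apply H; split; [split; [exact I | exact ne] | exact hz].
  - unfold Boule; rewrite Rminus_diag, Rabs_R0; simpl; lra. }
exists Y; split; [exact cY|]; intros t ht; split.
(* The image of [Y] and [Y] itself are both compared with iterate n + 1. Their distance is at most
   [K * (/ 2) ^ n] for every n, hence zero. *)
- apply Rminus_diag_uniq, Rabs_eq_0, Rle_antisym; [|apply Rabs_pos].
  set (K := C * exp (lam * t) + C).
  refine (is_lim_seq_le (fun _ => _) _ _ _ _ (is_lim_seq_const _)
            (is_lim_seq_half_pow K)).
  intros n.
  replace (volterra A G Y t - Y t)
    with ((volterra A G Y t - y (S n) t) - (Y t - y (S n) t)) by ring.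
  apply Rle_trans with (1 := Rabs_triang _ _); rewrite Rabs_Ropp.
  assert (h1 := hY t (S n)); rewrite clamp_id in h1 by exact ht.
  assert (hCn : 0 <= 2 * C * (/ 2) ^ n)
    by (apply Rmult_le_pos; [lra | left; apply hpow]).
  assert (h2 : Rabs (volterra A G Y t - y (S n) t)
     <= 2 * C * (/ 2) ^ n / 2 * exp (lam * t)).
  { refine (volterra_contraction A G Y (y n) T a g (2 * C * (/ 2) ^ n)
              hA hG cY (hy _) hbd ha hg _ _ t ht).
    - exact hCn.
    - intros s hs; assert (h := hY s n); rewrite clamp_id in h by exact hs.
      apply Rle_trans with (1 := h).
      destruct (hexp s hs) as [he _]; fold lam.
      nra. }
  replace (2 * C * (/ 2) ^ S n) with (C * (/ 2) ^ n) in h1 by (simpl; field).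
  replace (K * (/ 2) ^ n)
    with (2 * C * (/ 2) ^ n / 2 * exp (lam * t) + C * (/ 2) ^ n)
    by (unfold K; field).
  apply Rplus_le_compat; assumption.
- unfold Y.
  destruct (geometric_step_lim _ C hC (stepC _ (clamp_itv T t hT))) as [L _].
  refine (is_lim_seq_le (fun _ => 0) _ _ _ _ (is_lim_seq_const 0) L).
  intros n; apply hy0, clamp_itv, hT.
Qed.

Lemma linear_system_solution (T : R) (A G : R -> R) :
  0 < T -> (forall s, continuous A s) -> (forall s, continuous G s) ->
  (forall s, itv T s -> 0 <= A s /\ 0 <= G s) ->
  exists u v : R -> R,
    (forall t, itv T t -> is_derive u t (A t * v t)) /\
    (forall t, itv T t -> is_derive v t (G t * u t)) /\
    u 0 = 0 /\ v 0 = 1 /\ (forall t, itv T t -> 0 <= u t).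
Proof.
intros hT hA hG hp.
destruct (volterra_fixed_point T A G hT hA hG hp) as [Y [cY hY]].
(* [Y] is only known to be continuous; its image agrees with it on [0,T] and is differentiable in
   the two-sided sense. *)
exists (volterra A G Y), (volterra_inner G Y); split; [|split; [|split; [|split]]].
- intros t _; apply is_derive_volterra; auto.
- intros t ht; destruct (hY t ht) as [-> _].
  apply is_derive_volterra_inner; auto.
- unfold volterra; rewrite RInt_point; reflexivity.
- unfold volterra_inner; rewrite RInt_point; apply Rplus_0_r.
- intros t ht; destruct (hY t ht) as [-> h]; exact h.
Qed.

(** * Convexity and the extremal of the Euler-Lagrange equation *)

Lemma convex_of_derivative (T : R) (f df : R -> R) :
  (forall t, itv T t -> is_derive f t (df t)) -> increasing_on T df ->
  convex_on T f.
Proof.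
intros hf hi.
assert (mvt : forall x y, itv T x -> itv T y -> x <= y ->
  exists c, x <= c <= y /\ f y - f x = df c * (y - x)).
{ intros x y [hx _] [_ hy] hxy.
  destruct (MVT_gen f x y df) as [c hc];
    rewrite ?Rmin_left, ?Rmax_right in * by lra.
  - intros r hr; apply hf; unfold itv; lra.
  - intros r hr; apply continuity_pt_filterlim.
    eapply is_derive_continuous, hf; unfold itv; lra.
  - exists c; exact hc. }
(* The mean-value slopes on the two sides of the intermediate point are ordered because [df] is
   increasing. *)
assert (main : forall s t a, itv T s -> itv T t -> 0 <= a <= 1 -> s <= t ->
  f (a * s + (1 - a) * t) <= a * f s + (1 - a) * f t).
{ intros s t a hs ht ha hst.
  set (m := a * s + (1 - a) * t).
  assert (e1 : m - s = (1 - a) * (t - s)) by (unfold m; ring).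
  assert (e2 : t - m = a * (t - s)) by (unfold m; ring).
  assert (hm1 : s <= m) by nra; assert (hm2 : m <= t) by nra.
  assert (hm : itv T m) by (unfold itv in *; lra).
  destruct (mvt s m hs hm hm1) as [c1 [hc1 E1]].
  destruct (mvt m t hm ht hm2) as [c2 [hc2 E2]].
  assert (hc : df c1 <= df c2) by (apply hi; unfold itv in *; lra).
  rewrite e1 in E1; rewrite e2 in E2.
  assert (0 <= a * (1 - a) * (t - s) * (df c2 - df c1))
    by (repeat apply Rmult_le_pos; lra).
  apply Rminus_le_0.
  replace (a * f s + (1 - a) * f t - f m)
    with ((1 - a) * (f t - f m) - a * (f m - f s)) by ring.
  rewrite E1, E2; lra. }
intros s t a hs ht ha; destruct (Rle_lt_dec s t) as [h|h]; [auto|].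
assert (K := main t s (1 - a) ht hs ltac:(lra) ltac:(lra)).
replace (a * s + (1 - a) * t) with ((1 - a) * t + (1 - (1 - a)) * s) by ring.
lra.
Qed.

(** Shooting from the terminal time: z(T) = 0 becomes an initial condition for the reversed system,
    and by linearity one scalar factor then achieves z(0) = Q. Here [p] is the momentum -eta z',
    which inherits its sign from v. *)
Lemma euler_lagrange_solution (T Q : R) (theta eta : R -> R) :
  0 < T -> 0 <= Q -> positive_on T eta -> continuous_within T eta ->
  C1_on T theta -> increasing_on T theta ->
  exists z p : R -> R,
    (forall t, itv T t -> is_derive z t (- (p t / eta t))) /\
    (forall t, itv T t -> is_derive p t (- (deriv T theta t / 2 * z t))) /\
    z 0 = Q /\ z T = 0 /\ (forall t, itv T t -> 0 <= z t /\ 0 <= p t).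
Proof.
intros hT hQ hpos hc [htd htc] hincr.
assert (R : forall t, itv T t -> itv T (T - t)) by (unfold itv; intros; lra).
set (A := fun t => / eta (clamp T (T - t))).
set (G := fun t => deriv T theta (clamp T (T - t)) / 2).
assert (rev : forall f, continuous_within T f ->
  forall t, continuous (fun s => f (clamp T (T - s))) t).
{ intros f hf t.
  apply (continuous_comp (fun s => T - s) (fun s => f (clamp T s))).
  - apply @continuous_minus; [apply continuous_const | apply continuous_id].
  - apply continuous_clamp; assumption. }
assert (hA : forall t, continuous A t).
{ intros t; apply (continuous_comp (fun s => eta (clamp T (T - s))) Rinv).
  - apply rev, hc.
  - apply continuous_Rinv, Rgt_not_eq, hpos, clamp_itv, hT. }
assert (hG : forall t, continuous G t).
{ intros t; apply (continuous_mult _ (fun _ => / 2)).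
  - apply rev, htc.
  - apply continuous_const. }
assert (hA0 : forall t, 0 < A t)
  by (intros t; apply Rinv_0_lt_compat, hpos, clamp_itv, hT).
assert (hG0 : forall t, 0 <= G t).
{ intros t; apply Rdiv_le_0_compat; [|lra].
  apply increasing_deriv_nonneg; auto; apply clamp_itv, hT. }
destruct (linear_system_solution T A G hT hA hG)
  as [u [v [hu [hv [u0 [v0 up]]]]]].
{ intros s _; split; [left; apply hA0 | apply hG0]. }
assert (v1 : forall t, itv T t -> 1 <= v t).
{ intros t [ht0 htT]; rewrite <- v0.
  apply derivative_nonneg_le with (fun t => G t * u t); auto.
  - intros x hx; apply hv; unfold itv; lra.
  - intros x hx; apply Rmult_le_pos; [apply hG0 | apply up; unfold itv; lra]. }
assert (hTT : itv T T) by (unfold itv; lra).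
(* Since v stays at least 1, u has positive derivative; this makes the scaling factor [Q / u T]
   legitimate. *)
assert (uT : 0 < u T).
{ destruct (MVT_gen u 0 T (fun t => A t * v t)) as [c [hcT E]];
    rewrite ?Rmin_left, ?Rmax_right in * by lra.
  - intros x hx; apply hu; unfold itv; lra.
  - intros x hx; apply continuity_pt_filterlim.
    eapply is_derive_continuous, hu, hx.
  - assert (0 < A c * v c * T).
    { repeat apply Rmult_lt_0_compat; auto.
      specialize (v1 c hcT); lra. }
    lra. }
set (k := Q / u T).
assert (hk : 0 <= k) by (apply Rdiv_le_0_compat; assumption).
assert (hrev : forall f df t, is_derive f (T - t) df ->
  is_derive (fun s => k * f (T - s)) t (- (k * df))).
{ intros f df t h.
  replace (- (k * df)) with (k * (-1 * df)) by ring.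
  apply is_derive_scal.
  apply (is_derive_comp f (fun s => T - s)); [exact h|].
  auto_derive; [exact I | ring]. }
exists (fun t => k * u (T - t)), (fun t => k * v (T - t)).
split; [|split; [|split; [|split]]].
- intros t ht.
  replace (k * v (T - t) / eta t) with (k * (A (T - t) * v (T - t))).
  + apply hrev, hu, R, ht.
  + unfold A; replace (T - (T - t)) with t by ring; rewrite clamp_id by exact ht.
    unfold Rdiv; ring.
- intros t ht.
  replace (deriv T theta t / 2 * (k * u (T - t)))
    with (k * (G (T - t) * u (T - t))).
  + apply hrev, hv, R, ht.
  + unfold G; replace (T - (T - t)) with t by ring; rewrite clamp_id by exact ht.
    ring.
- rewrite Rminus_0_r; unfold k; field; lra.
- rewrite Rminus_diag, u0; ring.
- intros t ht; split; apply Rmult_le_pos; auto.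
  specialize (v1 (T - t) (R t ht)); lra.
Qed.

(** * Comparison of the cash of two strategies *)

Lemma nonneg_RInt_zero (T : R) (f : R -> R) :
  0 < T -> (forall t, continuous f t) -> (forall t, itv T t -> 0 <= f t) ->
  RInt f 0 T = 0 -> forall t, 0 < t < T -> f t = 0.
Proof.
intros hT hc hp h0 t ht.
assert (d : forall s, is_derive (fun r => RInt f 0 r) s (f s))
  by (intros s; apply is_derive_RInt_continuous, hc).
(* The running integral is non-decreasing and vanishes at both ends, so it is identically zero on
   [0,T]; [f] is its derivative. *)
assert (z : forall s, itv T s -> RInt f 0 s = 0).
{ intros s [hs0 hsT]; apply Rle_antisym.
  - apply Rle_trans with (RInt f 0 T); [|lra].
    apply (derivative_nonneg_le (fun r => RInt f 0 r) f); auto.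
    intros x hx; apply hp; unfold itv; lra.
  - apply Rle_trans with (RInt f 0 0); [rewrite RInt_point; apply Rle_refl|].
    apply (derivative_nonneg_le (fun r => RInt f 0 r) f); auto.
    intros x hx; apply hp; unfold itv; lra. }
rewrite <- (is_derive_unique _ _ _ (d t)).
apply is_derive_unique.
apply is_derive_ext_loc with (fun _ => 0); [|apply @is_derive_const].
assert (hm : 0 < Rmin t (T - t)) by (apply Rmin_glb_lt; lra).
exists (mkposreal _ hm); intros y hy.
change (Rabs (y - t) < Rmin t (T - t)) in hy.
assert (h3 := Rmin_l t (T - t)); assert (h4 := Rmin_r t (T - t)).
apply Rabs_def2 in hy; symmetry; apply z; unfold itv; lra.
Qed.

(** The integrand of [J] with the derivative as a separate argument, so that globally C1 extensions
    can be substituted for the data. *)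
Definition cash_rate (theta eta x dx : R -> R) (t : R) : R :=
  theta t * dx t * x t - eta t * (dx t) ^ 2.

Lemma continuous_cash_rate (theta eta x dx : R -> R) (t : R) :
  continuous theta t -> continuous eta t -> continuous x t -> continuous dx t ->
  continuous (cash_rate theta eta x dx) t.
Proof.
intros h1 h2 h3 h4; unfold cash_rate.
apply @continuous_minus.
- apply (continuous_mult (fun s => theta s * dx s) x); [|exact h3].
  apply (continuous_mult theta dx); assumption.
- apply (continuous_mult eta (fun s => dx s ^ 2)); [exact h2|].
  apply (continuous_mult dx (fun s => dx s * 1)); [exact h4|].
  apply (continuous_mult dx (fun _ => 1)); [exact h4 | apply continuous_const].
Qed.

Lemma J_extension (T : R) (theta eta x th et X dX : R -> R) :
  0 < T ->
  (forall t, itv T t -> th t = theta t) -> (forall t, itv T t -> et t = eta t) ->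
  (forall t, itv T t -> X t = x t) ->
  (forall t, itv T t -> dX t = deriv T x t) ->
  J T theta eta x = RInt (cash_rate th et X dX) 0 T.
Proof.
intros hT h1 h2 h3 h4; apply RInt_ext; rewrite Rmin_left, Rmax_right by lra.
intros t ht; unfold cash_rate.
rewrite h1, h2, h3, h4 by (unfold itv; lra); reflexivity.
Qed.

(* For an extremal [z] with momentum [p = eta z'], the difference of the two
   integrands is the derivative of [theta (x^2 - z^2) / 2 - 2 p (x - z)] minus
   [theta' / 2 (x - z)^2 + eta (x' - z')^2]. *)
Lemma J_extremal_comparison (T : R) (theta eta x z p : R -> R) :
  0 < T -> positive_on T eta -> C1_on T theta -> C1_on T eta ->
  increasing_on T theta -> C1_on T x -> C1_on T z ->
  (forall t, itv T t -> is_derive p t (deriv T theta t / 2 * z t)) ->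
  (forall t, itv T t -> p t = eta t * deriv T z t) ->
  let phi t := theta t * (x t ^ 2 - z t ^ 2) / 2 - 2 * p t * (x t - z t) in
  J T theta eta x - J T theta eta z <= phi T - phi 0 /\
  (J T theta eta x - J T theta eta z = phi T - phi 0 ->
   forall t, itv T t -> x t - z t = x 0 - z 0).
Proof.
intros hT hpos hth het hincr hx hz hdp hp phi.
destruct (C1_on_extension T theta hT hth) as [th [dth [dTh [cTh eTh]]]].
destruct (C1_on_extension T eta hT het) as [et [det [dEt [cEt eEt]]]].
destruct (C1_on_extension T x hT hx) as [X [dX [dXX [cX eX]]]].
destruct (C1_on_extension T z hT hz) as [Z [dZ [dZZ [cZ eZ]]]].
assert (h0 : itv T 0) by (unfold itv; lra).
assert (hTT : itv T T) by (unfold itv; lra).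
assert (hdth : forall t, itv T t -> 0 <= dth t).
{ intros t ht; destruct (eTh t ht) as [_ ->].
  apply increasing_deriv_nonneg; auto; apply hth. }
(* The nonnegative density of the cash lost relative to the extremal. *)
set (D := fun t => dth t / 2 * (X t - Z t) ^ 2 + et t * (dX t - dZ t) ^ 2).
assert (cth : forall t, continuous th t)
  by (intros; eapply is_derive_continuous; auto).
assert (cet : forall t, continuous et t)
  by (intros; eapply is_derive_continuous; auto).
assert (cXX : forall t, continuous X t)
  by (intros; eapply is_derive_continuous; auto).
assert (cZZ : forall t, continuous Z t)
  by (intros; eapply is_derive_continuous; auto).
assert (sq : forall f g : R -> R, (forall t, continuous f t) ->
  (forall t, continuous g t) -> forall t, continuous (fun s => (f s - g s) ^ 2) t).
{ intros f g hf hg t.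
  assert (hfg : continuous (fun s => f s - g s) t)
    by (apply @continuous_minus; auto).
  apply (continuous_mult (fun s => f s - g s) (fun s => (f s - g s) * 1));
    [exact hfg|].
  apply (continuous_mult (fun s => f s - g s) (fun _ => 1));
    [exact hfg | apply continuous_const]. }
assert (cD : forall t, continuous D t).
{ intros t; unfold D; apply @continuous_plus.
  - apply (continuous_mult (fun s => dth s / 2)); [|apply sq; auto].
    apply (continuous_mult dth (fun _ => / 2)); [apply cTh | apply continuous_const].
  - apply (continuous_mult et); [apply cet | apply sq; auto]. }
assert (pD : forall t, itv T t -> 0 <= D t).
{ intros t ht; specialize (hdth t ht); unfold D.
  assert (hE := hpos t ht); destruct (eEt t ht) as [<- _] in hE.
  apply Rplus_le_le_0_compat; apply Rmult_le_pos; try apply pow2_ge_0; lra. }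
assert (cR : forall Y dY : R -> R, (forall t, continuous Y t) ->
  (forall t, continuous dY t) -> forall t, continuous (cash_rate th et Y dY) t)
  by (intros; apply continuous_cash_rate; auto).
assert (int : forall f : R -> R, (forall t, continuous f t) ->
  is_RInt f 0 T (RInt f 0 T)).
{ intros f hf; apply (@RInt_correct R_CompleteNormedModule).
  apply (@ex_RInt_continuous R_CompleteNormedModule); auto. }
set (Phi := fun t => th t * (X t ^ 2 - Z t ^ 2) / 2 - 2 * p t * (X t - Z t)).
assert (ePhi : forall t, itv T t -> Phi t = phi t).
{ intros t ht; unfold Phi, phi.
  destruct (eTh t ht) as [-> _]; destruct (eX t ht) as [-> _].
  destruct (eZ t ht) as [-> _]; reflexivity. }
set (dPhi := fun t =>
  plus (minus (cash_rate th et X dX t) (cash_rate th et Z dZ t)) (D t)).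
assert (hPhi : is_RInt dPhi 0 T (minus (Phi T) (Phi 0))).
{ apply (is_RInt_derive Phi); rewrite Rmin_left, Rmax_right by lra.
  - intros t ht; assert (hdpt := hdp t ht); assert (hpt := hp t ht).
    destruct (eTh t ht) as [_ e1]; destruct (eEt t ht) as [e2 _].
    destruct (eZ t ht) as [e3 e4].
    rewrite <- e1, <- e3 in hdpt; rewrite <- e2, <- e4 in hpt.
    unfold Phi; auto_derive.
    + repeat split; eexists; eauto.
    (* Here the Euler-Lagrange equation enters: p' = theta' z / 2 and p = eta z' complete the two
       squares in [D]. *)
    + rewrite (is_derive_unique (fun s : R => th s) _ _ (dTh t)),
        (is_derive_unique (fun s : R => X s) _ _ (dXX t)),
        (is_derive_unique (fun s : R => Z s) _ _ (dZZ t)),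
        (is_derive_unique (fun s : R => p s) _ _ hdpt), hpt.
      unfold dPhi, plus, minus, plus, opp, cash_rate, D; simpl; field.
  - intros t _; unfold dPhi; apply @continuous_plus; [|apply cD].
    apply @continuous_minus; auto. }
assert (E : J T theta eta x - J T theta eta z + RInt D 0 T = phi T - phi 0).
{ rewrite (J_extension T theta eta x th et X dX hT
             (fun t ht => proj1 (eTh t ht)) (fun t ht => proj1 (eEt t ht))
             (fun t ht => proj1 (eX t ht)) (fun t ht => proj2 (eX t ht))).
  rewrite (J_extension T theta eta z th et Z dZ hT
             (fun t ht => proj1 (eTh t ht)) (fun t ht => proj1 (eEt t ht))
             (fun t ht => proj1 (eZ t ht)) (fun t ht => proj2 (eZ t ht))).
  rewrite <- !ePhi by assumption.
  assert (K := is_RInt_plus _ _ _ _ _ _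
    (is_RInt_minus _ _ _ _ _ _ (int _ (cR X dX cXX cX)) (int _ (cR Z dZ cZZ cZ)))
    (int _ cD)).
  exact (eq_trans (eq_sym (is_RInt_unique _ _ _ _ K))
           (is_RInt_unique _ _ _ _ hPhi)). }
split.
- assert (0 <= RInt D 0 T); [|lra].
  apply RInt_ge_0; [lra | eexists; apply int, cD |].
  intros t ht; apply pD; unfold itv; lra.
- intros e.
  (* Equality forces the integral of [D] to vanish. As theta' may be zero, only the eta term is
     exploited: eta > 0 gives x' = z' in the interior. *)
  assert (hD := nonneg_RInt_zero T D hT cD pD ltac:(lra)).
  assert (der : forall t, 0 < t < T -> dX t - dZ t = 0).
  { intros t ht; assert (ht' : itv T t) by (unfold itv; lra).
    specialize (hD t ht); specialize (hdth t ht'); unfold D in hD.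
    assert (hE := hpos t ht'); destruct (eEt t ht') as [<- _] in hE.
    assert (0 <= dth t / 2 * (X t - Z t) ^ 2)
      by (apply Rmult_le_pos; [lra | apply pow2_ge_0]).
    assert (0 <= (dX t - dZ t) ^ 2) by apply pow2_ge_0.
    apply Rsqr_0_uniq; rewrite Rsqr_pow2; nra. }
  intros t ht.
  destruct (eX t ht) as [<- _]; destruct (eZ t ht) as [<- _].
  destruct (eX 0 h0) as [<- _]; destruct (eZ 0 h0) as [<- _].
  symmetry; apply (derivative_zero_eq (fun s => X s - Z s)); [apply ht | |].
  + intros s hs; destruct ht as [_ ht].
    rewrite <- (der s) by lra; apply @is_derive_minus; auto.
  + intros s _; apply @continuous_minus; auto.
Qed.

(** The zero function is an extremal with zero momentum, and the comparison does not require equal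
    initial values. The boundary term that remains is -theta(0) Q^2 / 2. *)
Lemma J_nonpos (T Q : R) (theta eta x : R -> R) :
  0 < T -> positive_on T theta -> positive_on T eta ->
  C1_on T theta -> C1_on T eta -> increasing_on T theta ->
  Xi T Q x -> J T theta eta x <= 0.
Proof.
intros hT htpos hpos hth het hincr [[hx _] [x0 xT]].
destruct (C1_on_restriction T (fun _ => 0) (fun _ => 0) (fun _ => 0) hT)
  as [hz dz].
{ reflexivity. }
{ intros; apply @is_derive_const. }
{ intros; apply continuous_const. }
destruct (J_extremal_comparison T theta eta x (fun _ => 0) (fun _ => 0))
  as [H _]; auto.
{ intros t ht; rewrite Rmult_0_r; apply @is_derive_const. }
{ intros t ht; rewrite dz by exact ht; ring. }
assert (J0 : J T theta eta (fun _ => 0) = 0).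
{ unfold J; rewrite (RInt_ext _ (fun _ => 0)).
  - rewrite RInt_const; apply Rmult_0_r.
  - rewrite Rmin_left, Rmax_right by lra; intros t ht.
    rewrite dz by (unfold itv; lra); simpl; ring. }
rewrite J0, x0, xT in H.
assert (0 <= theta 0 * Q ^ 2).
{ apply Rmult_le_pos; [left; apply htpos; unfold itv; lra | apply pow2_ge_0]. }
lra.
Qed.

(** * Regularity, optimality and shape of the extremal *)

Lemma extremal_Xi (T Q : R) (theta eta z p : R -> R) :
  0 < T -> positive_on T eta -> C1_on T theta -> C1_on T eta ->
  (forall t, itv T t -> is_derive z t (- (p t / eta t))) ->
  (forall t, itv T t -> is_derive p t (- (deriv T theta t / 2 * z t))) ->
  z 0 = Q -> z T = 0 ->
  Xi T Q z /\ (forall t, itv T t -> deriv T z t = - (p t / eta t)).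
Proof.
intros hT hpos hth het dz dp z0 zT.
destruct (C1_on_extension T theta hT hth) as [th [dth [dTh [cTh eTh]]]].
destruct (C1_on_extension T eta hT het) as [et [det [dEt [cEt eEt]]]].
assert (et0 : forall t, itv T t -> et t <> 0).
{ intros t ht; destruct (eEt t ht) as [-> _]; apply Rgt_not_eq, hpos, ht. }
(* The first-order system provides the second derivative: z' = -p / eta is differentiable because p
   and eta are, and [z2] is its product-rule derivative. *)
set (z1 := fun t => - (p t * / et t)).
set (dp1 := fun t => - (dth t / 2 * z t)).
set (z2 := fun t => - (dp1 t * / et t + p t * (- det t * (/ et t * / et t)))).
assert (ez1 : forall t, itv T t -> - (p t / eta t) = z1 t).
{ intros t ht; unfold z1; destruct (eEt t ht) as [-> _]; reflexivity. }
assert (dp' : forall t, itv T t -> is_derive p t (dp1 t)).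
{ intros t ht; unfold dp1; destruct (eTh t ht) as [_ ->]; auto. }
assert (dz' : forall t, itv T t -> is_derive z t (z1 t)).
{ intros t ht; rewrite <- ez1 by exact ht; auto. }
assert (dz1 : forall t, itv T t -> is_derive z1 t (z2 t)).
{ intros t ht; specialize (et0 t ht); unfold z1; auto_derive.
  - repeat split; [eexists; eauto | eexists; eauto | exact et0].
  - rewrite (is_derive_unique (fun s : R => p s) _ _ (dp' t ht)),
      (is_derive_unique (fun s : R => et s) _ _ (dEt t)).
    unfold z2; field; exact et0. }
assert (cz2 : forall t, itv T t -> continuous z2 t).
{ intros t ht.
  assert (ci : continuous (fun s => / et s) t).
  { apply (continuous_comp et Rinv).
    - eapply is_derive_continuous, dEt.
    - apply continuous_Rinv, et0, ht. }
  assert (cz : continuous z t) by (eapply is_derive_continuous; eauto).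
  assert (cp : continuous p t) by (eapply is_derive_continuous; eauto).
  unfold z2; apply @continuous_opp, @continuous_plus.
  - apply (continuous_mult dp1); [|exact ci].
    apply @continuous_opp, (continuous_mult (fun s => dth s / 2)); [|exact cz].
    apply (continuous_mult dth (fun _ => / 2)); [apply cTh | apply continuous_const].
  - apply (continuous_mult p); [exact cp|].
    apply (continuous_mult (fun s => - det s)); [apply @continuous_opp, cEt|].
    apply (continuous_mult (fun s => / et s)); exact ci. }
destruct (C1_on_restriction T z z z1 hT) as [hz ez]; auto.
{ intros t ht; eapply is_derive_continuous; eauto. }
destruct (C1_on_restriction T (deriv T z) z1 z2 hT) as [hz1 _]; auto.
split; [repeat split; assumption || apply hz || apply hz1|].
intros t ht; rewrite ez1 by exact ht; auto.
Qed.

Lemma optimal_exists (T Q : R) (theta eta : R -> R) :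
  0 < T -> 0 <= Q -> positive_on T eta ->
  C1_on T theta -> C1_on T eta ->
  increasing_on T theta -> increasing_on T eta ->
  exists zeta : R -> R,
    optimal T theta eta Q zeta /\
    (forall xi : R -> R, optimal T theta eta Q xi ->
       forall t, itv T t -> xi t = zeta t) /\
    monotonic T zeta /\ convex_on T zeta /\
    (forall t, itv T t -> zeta t <= TWAP T Q t).
Proof.
intros hT hQ hpos hth het hti hei.
assert (cet : continuous_within T eta).
{ intros t ht; eapply cont_deriv, deriv_D_in; auto; apply het. }
destruct (euler_lagrange_solution T Q theta eta hT hQ hpos cet hth hti)
  as [z [p [dz [dp [z0 [zT hp]]]]]].
destruct (extremal_Xi T Q theta eta z p hT hpos hth het dz dp z0 zT) as [hXi ez].
assert (cmp : forall xi, Xi T Q xi ->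
  J T theta eta xi - J T theta eta z <= 0 /\
  (J T theta eta xi - J T theta eta z = 0 ->
   forall t, itv T t -> xi t = z t)).
{ intros xi [[hx _] [x0 xT]].
  (* The sign changes because here p = -eta z', while the comparison takes the momentum as eta
     z'. *)
  destruct (J_extremal_comparison T theta eta xi z (fun t => - p t)) as [H1 H2];
    auto.
  - apply hXi.
  - intros t ht.
    replace (deriv T theta t / 2 * z t)
      with (- - (deriv T theta t / 2 * z t)) by ring.
    apply @is_derive_opp; auto.
  - intros t ht; rewrite ez by exact ht; field.
    apply Rgt_not_eq, hpos, ht.
  (* Both strategies have the same endpoint values, so the boundary terms vanish. *)
  - rewrite z0, zT, x0, xT in H1, H2; split; [lra|].
    intros e t ht; assert (K := H2 ltac:(lra) t ht); lra. }
(* In z' = -p / eta both p and 1 / eta are nonnegative and non-increasing, the former because p' =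
   -theta' z / 2; hence z' is increasing. *)
assert (hcvx : convex_on T z).
{ apply convex_of_derivative with (fun t => - (p t / eta t)); [exact dz|].
  intros s t hs ht hst; apply Ropp_le_contravar.
  assert (pst : p t <= p s).
  { apply Ropp_le_cancel.
    apply (derivative_nonneg_le (fun r => - p r)
             (fun r => deriv T theta r / 2 * z r)); [exact hst | |].
    - intros r hr.
      replace (deriv T theta r / 2 * z r)
        with (- - (deriv T theta r / 2 * z r)) by ring.
      apply @is_derive_opp, dp; unfold itv in *; lra.
    - intros r hr; assert (hr' : itv T r) by (unfold itv in *; lra).
      apply Rmult_le_pos; [|apply hp, hr'].
      apply Rdiv_le_0_compat; [|lra].
      apply increasing_deriv_nonneg; auto; apply hth. }
  apply Rmult_le_compat.
  - apply hp, ht.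
  - left; apply Rinv_0_lt_compat, hpos, ht.
  - exact pst.
  - apply Rinv_le_contravar; [apply hpos, hs | apply hei; assumption]. }
exists z; split; [|split; [|split; [|split]]].
- split; [exact hXi|]; intros xi hxi; destruct (cmp xi hxi); lra.
- intros xi [hxi hopt]; destruct (cmp xi hxi) as [h1 h2]; apply h2.
  specialize (hopt z hXi); lra.
- intros t ht; rewrite ez by exact ht.
  assert (0 <= p t / eta t); [|lra].
  apply Rdiv_le_0_compat; [apply hp, ht | apply hpos, ht].
- exact hcvx.
- intros t [h0 hT1]; unfold TWAP.
  assert (hr : 0 <= t / T <= 1).
  { split; [apply Rdiv_le_0_compat; lra|].
    apply Rmult_le_reg_r with T; [lra|].
    unfold Rdiv; rewrite Rmult_assoc, Rinv_l by lra; lra. }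
  (* TWAP is the chord joining the two endpoints of the graph of z. *)
  assert (K := hcvx 0 T (1 - t / T) ltac:(unfold itv; lra) ltac:(unfold itv; lra)
                 ltac:(lra)).
  replace ((1 - t / T) * 0 + (1 - (1 - t / T)) * T) with t in K by (field; lra).
  rewrite z0, zT in K; lra.
Qed.

Theorem proposition13 (T : R) (theta eta : R -> R)
  (hT : 0 < T)
  (htheta_pos : positive_on T theta) (heta_pos : positive_on T eta)
  (htheta_C1 : C1_on T theta) (heta_C1 : C1_on T eta)
  (htheta_incr : increasing_on T theta) (heta_incr : increasing_on T eta) :
  (forall Q : R, 0 < Q ->
     exists zeta : R -> R,
       optimal T theta eta Q zeta /\
       (forall xi : R -> R, optimal T theta eta Q xi ->
          forall t, itv T t -> xi t = zeta t) /\
       monotonic T zeta /\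
       convex_on T zeta /\
       (forall t, itv T t -> zeta t <= TWAP T Q t)) /\
  ~ transaction_triggered_price_manipulation T theta eta /\
  ~ price_manipulation T theta eta.
Proof.
split; [|split].
- intros Q hQ; apply optimal_exists; auto; lra.
(* The unconstrained optimum is itself monotonic, so the supremum over monotonic strategies already
   dominates every competitor. *)
- intros [Q [zt [hQ [hzt hlt]]]].
  destruct (optimal_exists T Q theta eta) as [z [[hz hopt] [_ [hm _]]]]; auto; [lra|].
  destruct (Lub_Rbar_correct (fun x => exists zeta,
    Xi T Q zeta /\ monotonic T zeta /\ x = J T theta eta zeta)) as [ub _].
  assert (h1 := ub (J T theta eta z) (ex_intro _ z (conj hz (conj hm eq_refl)))).
  assert (h2 := Rbar_le_lt_trans _ _ _ h1 hlt).
  specialize (hopt zt hzt); simpl in h2; lra.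
- intros [Q [zeta [hQ [hz hlt]]]].
  assert (h := J_nonpos T Q theta eta zeta hT htheta_pos heta_pos htheta_C1
                 heta_C1 htheta_incr hz); lra.
Qed.
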